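(* Let $\Delta$ be a countable distance value set with $\inf\Delta=0$. Then $H_\Delta$, equipped with the subspace topology of $\mathrm{Iso}(\mathbb{U}_\Delta)$, has the strong Lévy property.
   Context: All topological spaces are assumed Hausdorff. A topological group $G$ has the strong Lévy property if there is an increasing sequence $(K_i)_{i\in\mathbb{N}}$ of finite subgroups of $G$, with normalized counting measures $\mu_i$ on $K_i$ (regarded as measures on $G$), such that (i) $\bigcup_i K_i$ is dense in $G$, and (ii) for each open neighborhood $V$ of the identity of $G$ and each sequence of sets $A_i\subseteq K_i$ with $\liminf_i\mu_i(A_i)>0$, one has $\lim_i\mu_i(VA_i)=1$. A distance value set is a nonempty set $\Delta$ of positive real numbers such that $\min\{x+y,\sup\Delta\}\in\Delta$ for all $x,y\in\Delta$ (where $\sup\Delta$ may be $+\infty$). A $\Delta$-metric space is a metric space whose nonzero distances all belong to $\Delta$. For countable $\Delta$, $\mathbb{U}_\Delta$ is the unique, up to isometry, countable $\Delta$-metric space that contains an isometric copy of every finite $\Delta$-metric space and is ultrahomogeneous (every isometry between finite subspaces extends to an isometry of $\mathbb{U}_\Delta$ onto itself). $\mathrm{Iso}(\mathbb{U}_\Delta)$ is the group of all isometries of $\mathbb{U}_\Delta$ onto itself, with the topology of pointwise convergence where $\mathbb{U}_\Delta$ carries its metric topology. $\mathcal{K}_\Delta$ is the class of all pairs $(X,G)$ where $X$ is a finite $\Delta$-metric space and $G$ is a finite group acting isometrically on $X$. An embedding from $(X_1,G_1)$ to $(X_2,G_2)$ is a pair $(\phi,\pi)$, where $\phi\colon G_1\to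 G_2$ is a group embedding and $\pi\colon X_1\to X_2$ is an isometric embedding, such that $\phi(g)(\pi(x))=\pi(g(x))$ for all $g\in G_1$, $x\in X_1$. It is known that $\mathcal{K}_\Delta$ is a Fraïssé class; $(X_\Delta,H_\Delta)$ denotes its Fraïssé limit, i.e. the (unique up to isomorphism) countable isometric action which is the union of an increasing chain of members of $\mathcal{K}_\Delta$, into which every member of $\mathcal{K}_\Delta$ embeds, and which is ultrahomogeneous (every isomorphism between two substructures belonging to $\mathcal{K}_\Delta$ extends to an automorphism). It is known that $X_\Delta$ is isometric to $\mathbb{U}_\Delta$, that $H_\Delta$ is isomorphic to Hall's universal locally finite group, and that $H_\Delta$ acts faithfully on $X_\Delta$; identifying $X_\Delta$ with $\mathbb{U}_\Delta$, $H_\Delta$ is regarded as a subgroup of $\mathrm{Iso}(\mathbb{U}_\Delta)$. *)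

(* Defs.v *)
From HB Require Import structures.
From mathcomp Require Import all_boot all_order all_algebra finmap.
From mathcomp Require Import all_classical all_reals all_analysis.

Set Implicit Arguments.
Unset Strict Implicit.
Unset Printing Implicit Defensive.

Import Order.TTheory GRing.Theory Num.Theory.
Import numFieldNormedType.Exports.

Local Open Scope classical_set_scope.
Local Open Scope group_scope.
Local Open Scope ring_scope.

HB.mixin Record isTopologicalGroup G of Group G & Topological G := {
  mulg_continuous : continuous (fun x : G * G => (x.1 * x.2)%g) ;
  invg_continuous : continuous (fun x : G => x^-1%g) ;
  tgroup_hausdorff : hausdorff_space G
}.

#[short(type="topologicalGroupType")]
HB.structure Definition TopologicalGroup :=
  { G of isTopologicalGroup G & Group G & Topological G }.

Record subgroup (G : groupType) := Subgroup {
  subgroup_set :> set G ;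
  subgroup_closed : group_closed (mem subgroup_set) }.

(* [set_type] carries the topology induced by the inclusion, whereas
   [subspace] would isolate the points outside of the subset. *)
Definition subgroup_type (G : topologicalGroupType) (K : subgroup G) : Type :=
  set_type K.

Section SubgroupType.
Variables (G : topologicalGroupType) (K : subgroup G).
Local Notation T := (subgroup_type K).

HB.instance Definition _ := SubType.copy T (set_type K).
HB.instance Definition _ := Topological.copy T (set_type K).
HB.instance Definition _ :=
  SubChoice_isSubGroup.Build G _ T (subgroup_closed K).

Let val_continuous : continuous (val : T -> G).
Proof. exact: (@initial_continuous (set_type K) G set_val). Qed.

Let to_sub_continuous (X : topologicalType) (f : X -> T) :
  continuous ((val : T -> G) \o f) -> continuous f.
Proof. exact: (@continuous_comp_initial (set_type K) X G set_val f). Qed.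

Let mulT_continuous : continuous (fun x : T * T => (x.1 * x.2)%g).
Proof.
apply: to_sub_continuous => x.
have -> : (val : T -> G) \o (fun x : T * T => (x.1 * x.2)%g) =
          (fun y : G * G => (y.1 * y.2)%g) \o (fun z => (val z.1, val z.2)).
  by apply/funext => z /=.
apply: continuous_comp; last exact: mulg_continuous.
apply: cvg_pair => /=.
  by apply: (@cvg_comp _ _ _ _ _ _ (nbhs x.1)); [exact: cvg_fst|exact: val_continuous].
by apply: (@cvg_comp _ _ _ _ _ _ (nbhs x.2)); [exact: cvg_snd|exact: val_continuous].
Qed.

Let invT_continuous : continuous (fun x : T => x^-1%g).
Proof.
apply: to_sub_continuous => x.
have -> : (val : T -> G) \o (fun x : T => x^-1%g) = (fun y : G => y^-1%g) \o val.
  by apply/funext => z /=.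
by apply: continuous_comp; [exact: val_continuous|exact: invg_continuous].
Qed.

Let T_hausdorff : hausdorff_space T.
Proof.
move=> p q pq; apply: val_inj; apply: tgroup_hausdorff => A B pA qB.
have [z [Az Bz]] := pq _ _ (val_continuous pA) (val_continuous qB).
by exists (val z).
Qed.

HB.instance Definition _ := isTopologicalGroup.Build T
  mulT_continuous invT_continuous T_hausdorff.

End SubgroupType.

Section StrongLevy.
Context {R : realType} {G : topologicalGroupType}.

Definition normalized_counting (K A : set G) : R :=
  #|` fset_set (A `&` K)|%:R / #|` fset_set K|%:R.

Definition strong_Levy : Prop :=
  exists K : nat -> subgroup G,
    [/\ forall i, finite_set (K i),
        forall i, K i `<=` K i.+1,
        dense (\bigcup_i (K i : set G)) &
        forall V : set G, open V -> V 1%g ->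
        forall A : nat -> set G, (forall i, A i `<=` K i) ->
          (0 < limn_einf (fun i => (normalized_counting (K i) (A i))%:E))%E ->
          (fun i => normalized_counting (K i)
             [set (v * a)%g | v in V & a in A i]) @ \oo --> (1 : R)].

End StrongLevy.
Arguments strong_Levy : clear implicits.

Section DeltaMetric.
Context {R : realType}.

Definition distance_value_set (Delta : set R) : Prop :=
  [/\ Delta !=set0,
      forall x, Delta x -> 0 < x &
      forall x y, Delta x -> Delta y ->
        (EFin @` Delta) (mine (x + y)%:E (ereal_sup (EFin @` Delta)))].

Definition delta_metric_on (Delta : set R) (X : metricType R) (A : set X) : Prop :=
  forall x y, A x -> A y -> mdist x y != 0 -> Delta (mdist x y).

Definition isometric_on (X Y : metricType R) (A : set X) (f : X -> Y) : Prop :=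
  forall x y, A x -> A y -> mdist (f x) (f y) = mdist x y.

Definition isometric (X Y : metricType R) (f : X -> Y) : Prop :=
  isometric_on setT f.

Definition is_Urysohn (Delta : set R) (U : metricType R) : Prop :=
  [/\ countable [set: U],
      delta_metric_on Delta [set: U],
      forall X : metricType R, finite_set [set: X] ->
        delta_metric_on Delta [set: X] ->
        exists f : X -> U, isometric f &
      forall (A B : set U) (f : U -> U), finite_set A -> finite_set B ->
        set_bij A B f -> isometric_on A f ->
        exists g : U -> U, [/\ isometric g, bijective g & {in A, g =1 f}]].

End DeltaMetric.

Definition Iso (R : realType) (U : metricType R) : Type :=
  set_type [set f : {ptws U -> U} | isometric (f : U -> U) /\ bijective f].

Section IsoGroup.
Context {R : realType} {U : metricType R}.
Local Notation T := (Iso U).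

HB.instance Definition _ := Topological.copy T
  (set_type [set f : {ptws U -> U} | isometric (f : U -> U) /\ bijective f]).

Definition iso_fun (g : T) : U -> U := \val g.

Lemma iso_isometry (g : T) : isometric (iso_fun g).
Proof. by have /set_mem[] := valP g. Qed.

Lemma iso_bijective (g : T) : bijective (iso_fun g).
Proof. by have /set_mem[] := valP g. Qed.

Definition mk_iso (f : U -> U) (fi : isometric f) (fb : bijective f) : T :=
  exist _ (f : {ptws U -> U}) (mem_set (conj fi fb)).

Lemma iso_ext (g h : T) : iso_fun g =1 iso_fun h -> g = h.
Proof. by move=> gh; apply: val_inj; apply/funext. Qed.

Let iso_inv_ex (g : T) : exists h : T, cancel (iso_fun g) (iso_fun h) /\
  cancel (iso_fun h) (iso_fun g).
Proof.
case: (iso_bijective g) => h gh hg.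
have hi : isometric h.
  by move=> x y _ _; rewrite -(iso_isometry g (x := h x)) // !hg.
have hb : bijective h by exists (iso_fun g).
by exists (mk_iso hi hb).
Qed.

Definition iso_inv (g : T) : T := projT1 (cid (iso_inv_ex g)).

Lemma iso_funK (g : T) : cancel (iso_fun g) (iso_fun (iso_inv g)).
Proof. by rewrite /iso_inv; case: cid => h []. Qed.

Lemma iso_invK (g : T) : cancel (iso_fun (iso_inv g)) (iso_fun g).
Proof. by rewrite /iso_inv; case: cid => h []. Qed.

Definition iso_one : T :=
  mk_iso (fun x y _ _ => erefl) (Bijective (frefl idfun) (frefl idfun)).

Let comp_isometry (g h : T) : isometric (iso_fun g \o iso_fun h).
Proof. by move=> x y _ _; rewrite /= !iso_isometry. Qed.

Definition iso_mul (g h : T) : T :=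
  mk_iso (comp_isometry g h) (bij_comp (iso_bijective g) (iso_bijective h)).

Let iso_mulA : associative iso_mul.
Proof. by move=> f g h; apply: iso_ext. Qed.
Let iso_mul1 : left_id iso_one iso_mul.
Proof. by move=> f; apply: iso_ext. Qed.
Let iso_mulr1 : right_id iso_one iso_mul.
Proof. by move=> f; apply: iso_ext. Qed.
Let iso_mulV : left_inverse iso_one iso_inv iso_mul.
Proof. by move=> f; apply: iso_ext => x; exact: iso_funK. Qed.
Let iso_mulrV : right_inverse iso_one iso_inv iso_mul.
Proof. by move=> f; apply: iso_ext => x; exact: iso_invK. Qed.

HB.instance Definition _ :=
  isGroup.Build T iso_mulA iso_mul1 iso_mulr1 iso_mulV iso_mulrV.

Lemma iso_funM (g h : T) x : iso_fun (g * h)%g x = iso_fun g (iso_fun h x).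
Proof. by []. Qed.

Lemma iso_fun1 x : iso_fun 1%g x = x.
Proof. by []. Qed.

Lemma iso_eval_continuous x : continuous (fun g : T => iso_fun g x).
Proof.
move=> g; apply: (@continuous_comp T {ptws U -> U} U \val (fun h => h x)).
  exact: initial_continuous.
exact: (@proj_continuous U (fun=> U) x).
Qed.

Lemma iso_cvgP (F : set_system T) (g : T) : Filter F ->
  F --> g <-> forall x, (fun h => iso_fun h x) @ F --> iso_fun g x.
Proof.
move=> FF; split=> [Fg x|Fg]; first exact: cvg_comp Fg (@iso_eval_continuous x g).
have : {ptws, iso_fun @ F --> iso_fun g} by apply/pointwise_cvgP.
move=> + A [_ [[B Bop <-] Bg BA]] => /(_ B) FB.
by apply: (filterS BA); apply: FB; exact: open_nbhs_nbhs.
Qed.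

Let mul_continuous : continuous (fun x : T * T => (x.1 * x.2)%g).
Proof.
move=> [g h]; apply/iso_cvgP => x /=; rewrite iso_funM.
apply/cvg_ballP => e e0.
have e20 : 0 < e / 2 by rewrite divr_gt0.
pose A := [set k : T | ball (iso_fun g (iso_fun h x)) (e / 2) (iso_fun k (iso_fun h x))].
pose B := [set k : T | ball (iso_fun h x) (e / 2) (iso_fun k x)].
have gA : nbhs g A by apply: iso_eval_continuous; exact: nbhsx_ballx.
have hB : nbhs h B by apply: iso_eval_continuous; exact: nbhsx_ballx.
exists (A, B) => // -[k l] [/= Ak Bl].
rewrite (splitr e) iso_funM; apply: ball_triangle Ak _.
by move: Bl; rewrite /B /= !ballEmdist /= iso_isometry.
Qed.

Let inv_continuous : continuous (fun g : T => g^-1%g).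
Proof.
move=> g; have FF := @nbhs_filter T g.
apply/iso_cvgP => x /=; apply/cvg_ballP => e e0.
pose y := iso_fun g^-1%g x.
have gyx : iso_fun g y = x by exact: iso_invK.
have : nbhs g [set k : T | ball (iso_fun g y) e (iso_fun k y)].
  by apply: iso_eval_continuous; exact: nbhsx_ballx.
apply: filterS => k /=; rewrite !ballEmdist /= gyx.
by rewrite -(iso_isometry k (x := y)) // iso_invK metric_sym.
Qed.

Let iso_hausdorff : hausdorff_space T.
Proof.
move=> g h gh; apply: iso_ext => x; apply: metric_hausdorff => A B gA hB.
have [z [Az Bz]] := gh _ _ (iso_eval_continuous gA) (iso_eval_continuous hB).
by exists (iso_fun z x).
Qed.

HB.instance Definition _ := isTopologicalGroup.Build T
  mul_continuous inv_continuous iso_hausdorff.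

End IsoGroup.

Section IsometricActions.
Context {R : realType}.

Record isometric_action := IsometricAction {
  action_space : metricType R ;
  action_group : groupType ;
  act : action_group -> action_space -> action_space ;
  act_one : forall x, act 1%g x = x ;
  act_mul : forall g h x, act (g * h)%g x = act g (act h x) ;
  act_isometry : forall g, isometric (act g) }.

Implicit Types M N : isometric_action.

Variable Delta : set R.

Definition in_K M : Prop :=
  [/\ finite_set [set: action_space M], finite_set [set: action_group M] &
      delta_metric_on Delta [set: action_space M]].

Definition embeds_in M N : Prop :=
  exists (phi : action_group M -> action_group N)
         (psi : action_space M -> action_space N),
    [/\ {morph phi : g h / (g * h)%g}, injective phi, isometric psi &
        forall g x, act (phi g) (psi x) = psi (act g x)].

Definition substructure_in_K M (S : set (action_space M))
    (K : set (action_group M)) : Prop :=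
  [/\ finite_set S, finite_set K, group_closed (mem K),
      delta_metric_on Delta S & forall g x, K g -> S x -> S (act g x)].

(* [phi] and [psi] matter only through their restrictions to [K1] and [S1]. *)
Definition isomorphism_on M
    (S1 : set (action_space M)) (K1 : set (action_group M))
    (S2 : set (action_space M)) (K2 : set (action_group M))
    (phi : action_group M -> action_group M)
    (psi : action_space M -> action_space M) : Prop :=
  [/\ set_bij K1 K2 phi,
      forall g h, K1 g -> K1 h -> phi (g * h)%g = (phi g * phi h)%g,
      set_bij S1 S2 psi,
      isometric_on S1 psi &
      forall g x, K1 g -> S1 x -> act (phi g) (psi x) = psi (act g x)].

Definition automorphism M phi psi : Prop :=
  @isomorphism_on M setT setT setT setT phi psi.

Definition is_Fraisse_limit M : Prop :=
  [/\ countable [set: action_space M] /\ countable [set: action_group M],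
      exists (S : nat -> set (action_space M))
             (K : nat -> set (action_group M)),
        [/\ forall n, substructure_in_K (S n) (K n),
            forall n, S n `<=` S n.+1 /\ K n `<=` K n.+1,
            \bigcup_n S n = setT &
            \bigcup_n K n = setT],
      forall N, in_K N -> embeds_in N M &
      forall S1 K1 S2 K2 phi psi,
        substructure_in_K S1 K1 -> substructure_in_K S2 K2 ->
        @isomorphism_on M S1 K1 S2 K2 phi psi ->
        exists phi' psi', [/\ automorphism phi' psi',
          forall g, K1 g -> phi' g = phi g & forall x, S1 x -> psi' x = psi x]].

End IsometricActions.
Arguments isometric_action : clear implicits.

(* When [f] is an isometry of [action_space M] onto [U], this is the set of all
   f \o act h \o f^-1. *)
Definition transported_set (R : realType) (M : isometric_action R)
    (U : metricType R) (f : action_space M -> U) : set (Iso U) :=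
  [set g | exists h : action_group M, forall x, iso_fun g (f x) = f (act h x)].

Lemma transported_set_closed (R : realType) (M : isometric_action R)
    (U : metricType R) (f : action_space M -> U) :
  group_closed (mem (transported_set f)).
Proof.
split; first by apply/mem_set; exists 1%g => x; rewrite act_one iso_fun1.
move=> g1 g2 /set_mem[h1 gh1] /set_mem[h2 gh2]; apply/mem_set.
exists (h1 * h2^-1)%g => x; rewrite act_mul -gh1 iso_funM; congr (iso_fun g1 _).
apply: (can_inj (iso_funK g2)); rewrite gh2 -act_mul mulgV act_one.
exact: iso_invK.
Qed.

Definition transported_group (R : realType) (M : isometric_action R)
    (U : metricType R) (f : action_space M -> U) : subgroup (Iso U) :=
  Subgroup (transported_set_closed f).

(* Main.v *)
From HB Require Import structures.
Require Import Defs.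
From mathcomp Require Import all_boot all_order fingroup all_algebra finmap.
From mathcomp Require Import all_classical all_reals all_analysis.
From mathcomp Require Import ring lra.

(** The group H of the Fraisse limit M is a union of finite groups, so the only
    issue is concentration of measure.  Let (S, K) be a finite substructure of M.
    The power K^n acts on S^n coordinatewise, and diagonals embed (S, K) into
    (S^n, K^n).  If S^n carries the average of the coordinate distances, then an
    element of K^n with few nontrivial coordinates moves every diagonal point
    only a little.  Since a subset of K^n of measure at least e has a Hamming
    neighborhood of small radius that is almost everything
    ([hamming_concentration]), a subset A of K^n of measure at least e satisfies
    mu(V A) >= 1 - e for n large, where V is the set of the elements moving all
    points of S by less than e.

    The average of distances in Delta need not be in Delta.  It is rounded up to
    a sum of elements of a finite set V of Delta which contains all distances of
    S and one very small element eta, available because inf Delta = 0.  Sums are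
    stable under addition, so rounding is subadditive and keeps the triangle
    inequality; it fixes the distances of S, and it rounds no t <= eta above eta
    ([exists_rounding]).

    By universality and ultrahomogeneity, (S^n, K^n) is realized inside M over
    (S, K) ([Fraisse_extension]).  So each K of a chain exhausting H is contained
    in a finite group L with the concentration property for the part S of the
    space that goes with it ([Levy_subgroup]), and a subsequence of these groups
    L is increasing.  Its union is the whole group, and the neighborhoods of 1
    for pointwise convergence are controlled by finite sets of points of the
    chain ([transport_nbhs1]).  Counting in M or in Iso U is the same because H
    acts faithfully ([Fraisse_limit_faithful]). *)

Set Implicit Arguments.
Unset Strict Implicit.
Unset Printing Implicit Defensive.

Import Order.TTheory GRing.Theory Num.Theory.

Local Open Scope classical_set_scope.
Local Open Scope ring_scope.

(** * Concentration of measure for the Hamming distance *)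

Section Hamming.
Variables (R : realType) (T : finType) (n : nat).
Implicit Types x y z : {ffun 'I_n -> T}.

Definition hamming x y : nat := #|[pred i | x i != y i]|.

Lemma hammingxx x : hamming x x = 0%N.
Proof. by apply: eq_card0 => i; rewrite inE eqxx. Qed.

Lemma hammingC x y : hamming x y = hamming y x.
Proof. by apply: eq_card => i; rewrite !inE eq_sym. Qed.

Lemma hamming_triangle x y z : (hamming x z <= hamming x y + hamming y z)%N.
Proof.
rewrite /hamming -cardUI (leq_trans _ (leq_addr _ _))//.
apply/subset_leq_card/fintype.subsetP => i; rewrite !inE.
by apply: contraR; rewrite negb_or !negbK => /andP[/eqP -> /eqP ->].
Qed.

Lemma hamming_le1 x y (k : 'I_n) :
  (forall i, i != k -> x i = y i) -> (hamming x y <= 1)%N.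
Proof.
move=> xy; rewrite -(card1 k); apply/subset_leq_card/fintype.subsetP => i.
by rewrite !inE; apply: contraR => /xy ->.
Qed.

(** The path from [y] to [x] that replaces the coordinates one at a time. *)
Definition hybrid (k : nat) x y :=
  [ffun i : 'I_n => if (i < k)%N then x i else y i].

Definition swap_at (k : 'I_n) (p : {ffun 'I_n -> T} * {ffun 'I_n -> T}) :=
  ([ffun i => if i == k then p.2 i else p.1 i],
   [ffun i => if i == k then p.1 i else p.2 i]).

Lemma swap_atK k : involutive (swap_at k).
Proof.
by case=> x y; congr pair; apply/ffunP => i; rewrite !ffunE; case: eqP.
Qed.

Lemma hybrid_swap (k : 'I_n) x y :
  hybrid k.+1 (swap_at k (x, y)).1 (swap_at k (x, y)).2 = hybrid k x y.
Proof.
apply/ffunP => i; rewrite !ffunE /= ltnS leq_eqVlt.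
by have [->|ik] := eqVneq i k; rewrite ?eqxx ?ltnn// (negPf (_ : val i != k)).
Qed.

Lemma hybrid_swapS (k : 'I_n) x y :
  hybrid k (swap_at k (x, y)).1 (swap_at k (x, y)).2 = hybrid k.+1 x y.
Proof.
have := hybrid_swap k (swap_at k (x, y)).1 (swap_at k (x, y)).2.
by rewrite -surjective_pairing swap_atK.
Qed.

(** Exchanging the [k]-th coordinates of [x] and [y] preserves the counting
    measure on pairs and reverses the [k]-th step of the hybrid path.  Writing
    [f x - f y] as the sum of these steps, the covariance of [f x] with the
    [k]-th step is hence half the average of a product of two differences of [f]
    along a single coordinate, which is at most 1.  So the variance grows like
    [n] and not like [n ^ 2], the order of the squared diameter. *)
Lemma Efron_Stein (f : {ffun 'I_n -> T} -> R) :
  (forall x y, (hamming x y <= 1)%N -> `|f x - f y| <= 1) ->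
  \sum_x \sum_y (f x - f y) ^+ 2 <= n%:R * #|{: {ffun 'I_n -> T}}|%:R ^+ 2.
Proof.
move=> f1; set N := #|_|.
pose D (p : {ffun 'I_n -> T} * {ffun 'I_n -> T}) (k : nat) : R :=
  f (hybrid k.+1 p.1 p.2) - f (hybrid k p.1 p.2).
have fB p : f p.1 - f p.2 = \sum_(k < n) D p k.
  rewrite -(big_mkord xpredT) /D telescope_sumr//; congr (f _ - f _);
  by apply/ffunP => i; rewrite ffunE ?ltn_ord.
have step (k : 'I_n) : (\sum_p f p.1 * D p k) *+ 2 <= (N ^ 2)%:R.
  have : \sum_p f p.1 * D p k = - \sum_p f (swap_at k p).1 * D p k.
    rewrite (reindex_inj (inv_inj (swap_atK k))) -sumrN; apply: eq_bigr => -[x y] _.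
    by rewrite /D hybrid_swap hybrid_swapS -mulrN opprB.
  rewrite mulr2n => {2}->; rewrite -sumrB.
  rewrite expnS expn1 -card_prod -sum1_card natr_sum.
  apply: ler_sum => -[x y] _; rewrite -mulrBl (le_trans (ler_norm _))// normrM.
  rewrite -[leRHS]mulr1 ler_pM// f1//; apply: (hamming_le1 (k := k)) => i ik;
    rewrite !ffunE /= ?(negPf ik)//.
  by rewrite ltnS leq_eqVlt (negPf (ik : val i != k)).
have swapK : involutive (fun p : {ffun 'I_n -> T} * {ffun 'I_n -> T} =>
    (p.2, p.1)) by case.
have -> : \sum_x \sum_y (f x - f y) ^+ 2 = \sum_p (f p.1 * (f p.1 - f p.2)) *+ 2.
  rewrite pair_big /=.
  rewrite sumrMnl mulr2n [X in _ + X](reindex_inj (inv_inj swapK))/=.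
  by rewrite -big_split; apply: eq_bigr => -[x y] _ /=; lra.
rewrite sumrMnl; under eq_bigr => p _ do rewrite fB mulr_sumr.
rewrite exchange_big /= -sumrMnl (le_trans (ler_sum _ (fun k _ => step k)))//.
by rewrite sumr_const card_ord natrX -[leLHS]mulr_natl.
Qed.

(** This is [Efron_Stein] for the distance to [A], which vanishes on [A] and is
    at least [r] on [B]: only the pairs in [A] x [B] are kept in the sum. *)
Lemma hamming_concentration (A B : {set {ffun 'I_n -> T}}) (r : R) :
  0 <= r -> (forall a b, a \in A -> b \in B -> r <= (hamming b a)%:R) ->
  #|A|%:R * #|B|%:R * r ^+ 2 <= n%:R * #|{: {ffun 'I_n -> T}}|%:R ^+ 2 :> R.
Proof.
move=> r0 AB; have [->|[a0 a0A]] := set_0Vmem A.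
  by rewrite cards0 !mul0r mulr_ge0.
pose h x := hamming x [arg min_(a < a0 in A) hamming x a].
have h_min x a : a \in A -> (h x <= hamming x a)%N.
  by rewrite /h; case: arg_minnP => // i iA; apply.
have hA a : a \in A -> h a = 0%N.
  by move=> aA; apply/eqP; rewrite -leqn0 -(hammingxx a) h_min.
have hB b : b \in B -> r <= (h b)%:R.
  by move=> bB; rewrite /h; case: arg_minnP => // i iA _; apply: AB.
have h_lip x y : (h x <= hamming x y + h y)%N.
  rewrite {2}/h; case: arg_minnP => // a aA _.
  exact: leq_trans (h_min _ _ aA) (hamming_triangle _ _ _).
apply: le_trans (Efron_Stein (f := fun x => (h x)%:R) _); last first.
  move=> x y xy; rewrite ler_distl lerBlDr !natr1 !ler_nat.
  rewrite (leq_trans (h_lip y x))/=; last by rewrite -add1n leq_add2r hammingC.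
  by rewrite (leq_trans (h_lip x y))// -add1n leq_add2r.
rewrite [leRHS](bigID (mem A)) /= ler_wpDr ?sumr_ge0//.
  by move=> x _; apply: sumr_ge0 => y _; exact: sqr_ge0.
rewrite -mulrA -sumr_const mulr_suml; apply: ler_sum => a aA; rewrite mul1r.
rewrite [leRHS](bigID (mem B)) /= ler_wpDr ?sumr_ge0//.
  by move=> y _; exact: sqr_ge0.
rewrite -sumr_const mulr_suml; apply: ler_sum => b bB; rewrite mul1r.
by rewrite hA// sub0r sqrrN lerXn2r ?nnegrE// hB.
Qed.

End Hamming.

(** * Rounding up to a distance value *)

Section DistanceValues.
Variables (R : realType) (Delta : set R).
Hypothesis dvs : distance_value_set Delta.

Lemma distance_value_gt0 x : Delta x -> 0 < x.
Proof. by case: dvs => _ + _; apply. Qed.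

(** No truncation happens below an element [z] of [Delta], as [z] is at most the
    supremum of [Delta]. *)
Lemma distance_valueD x y z :
  Delta x -> Delta y -> Delta z -> x + y <= z -> Delta (x + y).
Proof.
move=> dx dy dz xyz; case: dvs => _ _ /(_ _ _ dx dy)[t dt].
rewrite /= (min_idPl _) => [[<-]//|].
rewrite (le_trans (_ : _ <= z%:E)%E) ?lee_fin//.
by apply: ereal_sup_ubound; exists z.
Qed.

Lemma distance_value_small (e : R) :
  inf Delta = 0 -> 0 < e -> exists2 x, Delta x & x < e.
Proof.
move=> d0 e0; case: dvs => -[y dy] dpos _.
have : has_inf Delta by split; [exists y|exists 0 => x /dpos/ltW].
by move=> /(inf_adherent e0)[x dx]; rewrite d0 add0r => xe; exists x.
Qed.

Lemma distance_value_sum (l : seq R) z : Delta z ->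
  {in l, forall x, Delta x} -> 0 < \sum_(x <- l) x <= z ->
  Delta (\sum_(x <- l) x).
Proof.
move=> dz; elim: l => [|x l IH] dl; first by rewrite big_nil ltxx.
have dx : Delta x by apply: dl; rewrite mem_head.
have {}dl : {in l, forall x, Delta x}.
  by move=> t tl; apply: dl; rewrite inE tl orbT.
rewrite big_cons => /andP[_ xz].
have : 0 <= \sum_(y <- l) y.
  by rewrite big_seq sumr_ge0// => i /dl/distance_value_gt0/ltW.
rewrite le_eqVlt => /orP[/eqP <-|l0]; first by rewrite addr0.
apply: (distance_valueD dx _ dz xz); apply: IH; rewrite // l0 (le_trans _ xz)//.
by rewrite lerDr ltW// distance_value_gt0.
Qed.

Fixpoint short_sums (V : seq R) (N : nat) : seq R :=
  if N is k.+1 then 0 :: [seq x + y | x <- V, y <- short_sums V k] else [:: 0].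

Lemma short_sumsP V N s :
  reflect (exists l : seq R,
      [/\ {subset l <= V}, (size l <= N)%N & s = \sum_(x <- l) x])
    (s \in short_sums V N).
Proof.
apply: (iffP idP) => [|[l [lV lN ->]]]; last first.
  elim: N l lV lN => [|N IH] [|x l] //= lV lN; rewrite ?big_nil ?mem_head//.
  rewrite big_cons inE allpairs_f ?orbT ?lV ?mem_head// IH// => y yl.
  by apply: lV; rewrite inE yl orbT.
elim: N s => [|N IH] s /=.
  by rewrite inE => /eqP ->; exists [::]; rewrite big_nil.
rewrite inE => /orP[/eqP ->|]; first by exists [::]; rewrite big_nil.
case/allpairsP => -[x y] /= [xV /IH[l [lV lN ->]] ->]; exists (x :: l).
rewrite big_cons; split=> // z; rewrite inE => /orP[/eqP ->//|]; exact: lV.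
Qed.

(** [r t] is the least sum of elements of [V] in the interval from [t] to [D].
    It exists because only finitely many such sums are at most [D], the elements
    of [V] being bounded away from 0.  If [r s + r u] is at most [D], it is
    itself such a sum and bounds [r (s + u)]; otherwise [D] does. *)
Lemma exists_rounding (V : seq R) (D : R) :
  {in V, forall v, Delta v /\ v <= D} -> D \in V ->
  exists r : R -> R, [/\ r 0 = 0,
    forall t, t <= D -> t <= r t,
    forall t, 0 < t <= D -> Delta (r t),
    {in V, forall v, r v = v} /\ (forall t v, v \in V -> t <= v -> r t <= v) &
    forall t s u, 0 <= t <= D -> 0 <= s <= D -> 0 <= u <= D ->
      t <= s + u -> r t <= r s + r u].
Proof.
move=> VD DV.
have [dD _] := VD _ DV.
pose m := \big[Num.min/D]_(v <- V) v.
have m0 : 0 < m.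
  rewrite /m big_seq; elim/big_ind : _ => [||v /VD[]]; first exact: distance_value_gt0.
    by move=> x y x0 y0; rewrite lt_min x0.
  by move=> + _; exact: distance_value_gt0.
have Vm v : v \in V -> m <= v by move=> vV; exact: bigmin_inf_seq vV _ _.
pose N := (Num.truncn (D / m)).+1.
(* Below [D] all sums have at most [N] terms, so [short_sums V N] is stable under
   the additions that do not exceed [D]. *)
have long l : {subset l <= V} -> \sum_(x <- l) x <= D -> (size l <= N)%N.
  move=> lV lD; rewrite ltnW// -(ltr_nat R) (le_lt_trans _ (truncnS_gt _))//.
  rewrite ler_pdivlMr// (le_trans _ lD)//.
  elim: l lV {lD} => [|x l IH] lV; first by rewrite big_nil mul0r.
  rewrite big_cons /= -natr1 mulrDl mul1r addrC lerD ?Vm ?lV ?mem_head//.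
  by apply: IH => y yl; apply: lV; rewrite inE yl orbT.
pose S := short_sums V N.
pose r t := \big[Num.min/D]_(s <- S | (t <= s) && (s <= D)) s.
have SV v : v \in V -> v \in S.
  move=> vV; apply/short_sumsP; exists [:: v]; rewrite big_seq1; split=> // x.
  by rewrite inE => /eqP ->.
have r_le t s : s \in S -> s <= D -> t <= s -> r t <= s.
  by move=> sS sD ts; apply: bigmin_inf_seq sS _ _; rewrite ?ts.
have r_in t : t <= D -> [/\ r t \in S, t <= r t & r t <= D].
  move=> tD; rewrite /r big_seq_cond; elim/big_ind: _.
  - by split=> //; exact: SV.
  - by move=> x y hx hy; rewrite /Num.min; case: ifP.
  - by move=> s /and3P[].
have S0 : 0 \in S by apply/short_sumsP; exists [::]; rewrite big_nil.
have D0 : 0 < D := distance_value_gt0 dD.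
exists r; split.
- have [_ ? _] := r_in 0 (ltW D0).
  by apply/le_anti/andP; split=> //; exact: r_le (ltW D0) _.
- by move=> t /r_in[].
- move=> t /andP[t0 /r_in[/short_sumsP[l [lV _ rl]] tr rD]].
  rewrite rl; apply: (distance_value_sum dD) => [x /lV/VD[]//|].
  by rewrite -rl rD (lt_le_trans t0 tr).
- split=> [v vV|t v vV tv]; have [_ vD] := VD _ vV; last first.
    by apply: r_le => //; exact: SV.
  have [_ ? _] := r_in v vD.
  by apply/le_anti/andP; split=> //; exact: r_le (SV _ vV) vD _.
- move=> t s u /andP[t0 tD] /andP[s0 sD] /andP[u0 uD] tsu.
  have [/short_sumsP[ls [lsV _ rs]] sr _] := r_in s sD.
  have [/short_sumsP[lu [luV _ ru]] ur _] := r_in u uD.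
  have [suD|Dsu] := leP (r s + r u) D; last first.
    by have [_ _ rD] := r_in t tD; exact: le_trans rD (ltW Dsu).
  apply: r_le => //; last by rewrite (le_trans tsu)// lerD.
  have lV : {subset ls ++ lu <= V} by move=> x; rewrite mem_cat => /orP[/lsV|/luV].
  apply/short_sumsP; exists (ls ++ lu); rewrite big_cat -rs -ru; split=> //.
  by apply: long; rewrite // big_cat -rs -ru.
Qed.

End DistanceValues.

(** * Metric spaces and groups from finite data *)

Section DistType.
Variables (R : realType).

Definition is_dist (T : Type) (d : T -> T -> R) : Prop :=
  [/\ forall x, d x x = 0, forall x y, d x y = 0 -> x = y,
      forall x y, d x y = d y x & forall y x z, d x z <= d x y + d y z].

Lemma is_dist_ge0 (T : Type) (d : T -> T -> R) x y : is_dist d -> 0 <= d x y.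
Proof.
case=> d0 _ dC dD; rewrite -(@pmulrn_lge0 _ _ 2)// mulr2n {2}dC -(d0 x).
exact: dD.
Qed.

(** [dP] is an argument so that the metric structure can be inferred. *)
Definition dist_type (T : choiceType) (d : T -> T -> R) (dP : is_dist d) : Type := T.

HB.instance Definition _ (T : choiceType) (d : T -> T -> R) (dP : is_dist d) :=
  Choice.copy (dist_type dP) T.

HB.instance Definition _ (T : choiceType) (d : T -> T -> R) (dP : is_dist d) :=
  isMetric.Build R (dist_type dP)
    (let: And4 h _ _ _ := dP in h) (let: And4 _ h _ _ := dP in h)
    (let: And4 _ _ h _ := dP in h) (let: And4 _ _ _ h := dP in h).

Lemma dist_typeE (T : choiceType) (d : T -> T -> R) (dP : is_dist d)
  (x y : dist_type dP) : mdist x y = d x y.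
Proof. by []. Qed.

End DistType.

Section FinSubgroup.
Variables (gT : groupType) (K : {fset gT}).

(** [Kc] is an argument so that the group structure can be inferred. *)
Definition fin_subgroup (Kc : group_closed (mem K)) : Type := K.

Variable Kc : group_closed (mem K).
HB.instance Definition _ := SubType.copy (fin_subgroup Kc) K.
HB.instance Definition _ := Finite.copy (fin_subgroup Kc) K.
HB.instance Definition _ :=
  SubChoice_isSubGroup.Build gT _ (fin_subgroup Kc) Kc.

End FinSubgroup.

(** * The power of a finite isometric action *)

Section Power.
(* Below, [V], [D] and [r] are a finite set of distance values, its maximum and
   the rounding that [exists_rounding] provides for them. *)
Variables (R : realType) (Delta : set R) (X : finType) (d : X -> X -> R).
Hypothesis dP : is_dist d.
Variables (V : seq R) (D : R) (r : R -> R).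
Hypotheses (D0 : 0 < D) (dD : forall x y, d x y <= D).
Hypothesis dV : forall x y, d x y != 0 -> d x y \in V.
Hypotheses (r0 : r 0 = 0) (r_ge : forall t, t <= D -> t <= r t)
  (r_Delta : forall t, 0 < t <= D -> Delta (r t))
  (r_id : {in V, forall v, r v = v})
  (r_le : forall t v, v \in V -> t <= v -> r t <= v)
  (r_sub : forall t s u, 0 <= t <= D -> 0 <= s <= D -> 0 <= u <= D ->
     t <= s + u -> r t <= r s + r u).
Variables (n : nat) (G : finGroupType) (a : G -> X -> X).
Hypotheses (a1 : forall x, a 1%g x = x)
  (aM : forall g h x, a (g * h)%g x = a g (a h x))
  (a_isom : forall g x y, d (a g x) (a g y) = d x y).

Local Notation Y := {ffun 'I_n.+1 -> X}.
Local Notation L := {ffun 'I_n.+1 -> G}.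
Implicit Types (x y z : Y) (g h : L).

Definition mean_dist x y : R := (\sum_i d (x i) (y i)) / n.+1%:R.

Lemma mean_dist_bound x y : 0 <= mean_dist x y <= D.
Proof.
rewrite /mean_dist divr_ge0 ?sumr_ge0// => [|i _]; last exact: is_dist_ge0 dP.
rewrite ler_pdivrMr ?ltr0n//= mulr_natr -[in leRHS](card_ord n.+1) -sumr_const.
by apply: ler_sum => i _; exact: dD.
Qed.

Lemma mean_dist_eq0 x y : mean_dist x y = 0 -> x = y.
Proof.
move=> /eqP; rewrite mulf_eq0 invr_eq0 pnatr_eq0 orbF psumr_eq0; last first.
  by move=> i _; exact: is_dist_ge0 dP.
by move=> /allP xy; apply/ffunP => i; case: dP => _ + _ _; apply; apply/eqP/xy.
Qed.

Lemma mean_dist_triangle y x z : mean_dist x z <= mean_dist x y + mean_dist y z.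
Proof.
rewrite -mulrDl ler_wpM2r ?invr_ge0// -big_split ler_sum// => i _.
by case: dP => _ _ _; exact.
Qed.

Definition power_dist x y : R := r (mean_dist x y).

Lemma power_distP : is_dist power_dist.
Proof.
case: (dP) => d0 _ dC _; split.
- by move=> x; rewrite /power_dist /mean_dist big1 ?mul0r.
- move=> x y rxy; apply: mean_dist_eq0; have /andP[m0 mD] := mean_dist_bound x y.
  by apply/le_anti; rewrite m0 andbT -rxy r_ge.
- by move=> x y; congr (r (_ / _)); apply: eq_bigr => i _; rewrite dC.
- move=> y x z.
  by apply: r_sub; [exact: mean_dist_bound..|exact: mean_dist_triangle].
Qed.

Lemma power_dist_Delta x y : power_dist x y != 0 -> Delta (power_dist x y).
Proof.
move=> xy; apply: r_Delta; have /andP[m0 ->] := mean_dist_bound x y.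
rewrite andbT lt_neqAle m0 andbT eq_sym.
by apply: contraNneq xy => m; rewrite /power_dist m r0.
Qed.

Lemma power_dist_const u v : power_dist [ffun=> u] [ffun=> v] = d u v.
Proof.
have -> : power_dist [ffun=> u] [ffun=> v] = r (d u v).
  congr (r _); rewrite /mean_dist; under eq_bigr do rewrite !ffunE.
  by rewrite sumr_const card_ord -[X in X / _]mulr_natr mulfK ?pnatr_eq0.
by have [->|/dV/r_id->//] := eqVneq (d u v) 0.
Qed.

(** The mean distance is at most [D] times the proportion of the coordinates
    where [x] and [y] differ, and [r] does not round above the element [v] of
    [V]. *)
Lemma power_dist_hamming x y v :
  v \in V -> D * (hamming x y)%:R <= v * n.+1%:R -> power_dist x y <= v.
Proof.
move=> vV xy; apply: r_le => //; rewrite ler_pdivrMr ?ltr0n// (le_trans _ xy)//.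
rewrite (bigID (fun i => x i == y i)) /= big1 ?add0r => [|i /eqP ->]; last by case: dP.
rewrite mulr_natr /hamming -sumr_const; apply: le_trans (ler_sum _ _) _.
  by move=> i _; exact: dD.
by rewrite lexx.
Qed.

Definition power_act g (x : dist_type power_distP) : dist_type power_distP :=
  [ffun i => a (g i) (x i)].

Lemma power_act1 x : power_act 1%g x = x.
Proof. by apply/ffunP => i; rewrite !ffunE a1. Qed.

Lemma power_actM g h x : power_act (g * h)%g x = power_act g (power_act h x).
Proof. by apply/ffunP => i; rewrite !ffunE aM. Qed.

Lemma power_act_isometric g : isometric (power_act g).
Proof.
move=> x y _ _; rewrite !dist_typeE; congr (r (_ / _)).
by apply: eq_bigr => i _; rewrite !ffunE a_isom.
Qed.

Definition power_action : isometric_action R :=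
  @IsometricAction R (dist_type power_distP) L power_act
    power_act1 power_actM power_act_isometric.

Lemma power_action_in_K : in_K Delta power_action.
Proof.
split; [exact: (@finite_finset Y)|exact: (@finite_finset L)|].
by move=> x y _ _; exact: power_dist_Delta.
Qed.

Lemma power_action_small (v : R) g h (u : X) : v \in V ->
  D * (hamming g h)%:R <= v * n.+1%:R ->
  power_dist (power_act (g * h^-1)%g [ffun=> u]) [ffun=> u] <= v.
Proof.
move=> vV gh; apply: (power_dist_hamming vV); apply: le_trans gh.
rewrite ler_pM2l// ler_nat; apply/subset_leq_card/fintype.subsetP => i.
by rewrite !inE !ffunE; apply: contraNneq => ->; rewrite mulgV a1.
Qed.

(** Let [E] be the set of the [g] such that [g * h^-1] moves all diagonal points
    by at most [v], for some [h] in [A].  Points outside [E] are at Hamming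
    distance at least [v / D * n.+1] from [A], so the measures of [A] and of the
    complement of [E] have a product at most [D ^ 2 / (v ^ 2 * n.+1)], which is
    at most [c ^ 2]. *)
Lemma power_action_concentration (v c : R) (A : {set L}) :
  v \in V -> 0 < v -> 0 < c -> D ^+ 2 <= c ^+ 2 * v ^+ 2 * n.+1%:R ->
  c * #|L|%:R <= #|A|%:R ->
  (1 - c) * #|L|%:R <=
  #|[set g : L | [exists h in A, [forall u : X,
    power_dist (power_act (g * h^-1)%g [ffun=> u]) [ffun=> u] <= v]]]%SET|%:R.
Proof.
move=> vV v0 c0 nbig cA; set E := finset _.
have L0 : 0 < #|L|%:R :> R by rewrite ltr0n; apply/card_gt0P; exists 1%g.
have far g h : g \in A -> h \in ~: E -> v / D * n.+1%:R <= (hamming h g)%:R.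
  move=> gA; rewrite !inE => /negP hE; rewrite leNgt; apply/negP => hg.
  apply: hE; apply/existsP; exists g; rewrite gA; apply/forallP => u.
  apply: power_action_small => //; rewrite mulrC -ler_pdivlMr//.
  by rewrite ltW// (lt_le_trans hg)// mulrAC.
have rho0 : 0 <= v / D * n.+1%:R by rewrite mulr_ge0// ltW// divr_gt0.
have := hamming_concentration rho0 far.
rewrite (cardsCs (~: E)) finset.setCK natrB ?max_card//.
have Ne : 0 <= #|L|%:R - #|E|%:R :> R by rewrite subr_ge0 ler_nat max_card.
set N : R := #|L|%:R in L0 cA Ne *; set e : R := #|E|%:R in Ne *.
set k : R := n.+1%:R in nbig *; have k0 : 0 < k by rewrite ltr0n.
move=> h; suff : N - e <= c * N.
  by rewrite mulrBl mul1r lerBlDr addrC -lerBlDr.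
have w0 : 0 < (v / D) ^+ 2 by rewrite exprn_gt0// divr_gt0.
have {}nbig : 1 <= c ^+ 2 * (v / D) ^+ 2 * k.
  by rewrite exprMn exprVn mulrA mulrAC ler_pdivlMr ?exprn_gt0// mul1r.
rewrite exprMn in h; set w := (v / D) ^+ 2 in w0 nbig h.
have h1 : c * N * (N - e) * (w * k ^+ 2) <= k * N ^+ 2.
  apply: le_trans h; rewrite ler_wpM2r ?ler_wpM2r//.
  by rewrite mulr_ge0 ?sqr_ge0// ltW.
have h2 : c * N * (w * k ^+ 2) * (N - e) <= c * N * (w * k ^+ 2) * (c * N).
  rewrite mulrAC (le_trans h1)//.
  have -> : c * N * (w * k ^+ 2) * (c * N) = c ^+ 2 * w * k * (k * N ^+ 2) by ring.
  by rewrite ler_peMl// mulr_ge0 ?sqr_ge0// ltW.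
move: h2; rewrite ler_pM2l//.
by apply: mulr_gt0; [exact: mulr_gt0|apply: mulr_gt0 => //; exact: exprn_gt0].
Qed.

End Power.

(** * Extensions inside the Fraisse limit *)

Lemma group_closed_image (G H : groupType) (phi : G -> H) (K : set G) :
  {morph phi : x y / (x * y)%g} -> group_closed (mem K) ->
  group_closed (mem (phi @` K)).
Proof.
move=> phiM [K1 KB].
have phi1 : phi 1%g = 1%g by apply: (mulgI (phi 1%g)); rewrite -phiM !mulg1.
have phiV h : phi h^-1%g = (phi h)^-1%g.
  by apply: (mulgI (phi h)); rewrite -phiM !mulgV.
split; first by apply/mem_set; exists 1%g => //; exact/set_mem.
move=> _ _ /set_mem[g Kg <-] /set_mem[h Kh <-]; apply/mem_set.
by exists (g * h^-1)%g; rewrite ?phiM ?phiV//; apply/set_mem/KB; exact/mem_set.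
Qed.

Section FraisseLimit.
Variables (R : realType) (Delta : set R) (M : isometric_action R).
Hypothesis M_limit : is_Fraisse_limit Delta M.

(** Universality embeds [N] somewhere in [M]; the copy of [(S, K)] inside this
    copy of [N] is isomorphic to [(S, K)], and moving it back by an automorphism
    of [M] makes the embedding of [N] extend the inclusion of [(S, K)]. *)
Lemma Fraisse_extension (S : {fset action_space M}) (K : {fset action_group M})
    (Kc : group_closed (mem K)) (N : isometric_action R)
    (phi0 : fin_subgroup Kc -> action_group N) (psi0 : S -> action_space N) :
  delta_metric_on Delta [set` S] ->
  (forall g x, g \in K -> x \in S -> act g x \in S) ->
  in_K Delta N -> {morph phi0 : g h / (g * h)%g} -> injective phi0 ->
  (forall x y, mdist (psi0 x) (psi0 y) = mdist (val x) (val y)) ->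
  (forall g x y, act (val g) (val x) = val y -> act (phi0 g) (psi0 x) = psi0 y) ->
  exists (phi : action_group N -> action_group M)
         (psi : action_space N -> action_space M),
    [/\ [/\ {morph phi : g h / (g * h)%g}, injective phi, isometric psi &
        forall g x, act (phi g) (psi x) = psi (act g x)],
        forall g, phi (phi0 g) = val g & forall x, psi (psi0 x) = val x].
Proof.
move=> dS KS KN phi0M phi0I psi0D phi0A.
case: M_limit => _ _ /(_ N KN)[phe [pse [pheM pheI pseD pheA]]] ultra.
pose phi1 g := oapp (fun k => phe (phi0 k)) g (insub g : option (fin_subgroup Kc)).
pose psi1 x := oapp (fun k => pse (psi0 k)) x (insub x : option S).
have phi1E (k : fin_subgroup Kc) : phi1 (val k) = phe (phi0 k).
  by rewrite /phi1 valK.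
have psi1E (x : S) : psi1 (val x) = pse (psi0 x) by rewrite /psi1 valK.
have phi1M g h : g \in K -> h \in K -> phi1 (g * h)%g = (phi1 g * phi1 h)%g.
  move=> gK hK; rewrite -[g]/(val (Sub g gK : fin_subgroup Kc)).
  rewrite -[h]/(val (Sub h hK : fin_subgroup Kc)).
  by rewrite !phi1E -pheM -phi0M -phi1E.
have phi1I : {in [set` K] &, injective phi1}.
  move=> g h /set_mem /= gK /set_mem /= hK.
  rewrite -[g]/(val (Sub g gK : fin_subgroup Kc)).
  rewrite -[h]/(val (Sub h hK : fin_subgroup Kc)).
  by rewrite !phi1E => /pheI/phi0I ->.
have psi1D : isometric_on [set` S] psi1.
  move=> x y /= xS yS; rewrite -[x]/(val [` xS]%fset) -[y]/(val [` yS]%fset).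
  by rewrite !psi1E pseD// psi0D.
have phi1A g x : g \in K -> x \in S -> act (phi1 g) (psi1 x) = psi1 (act g x).
  move=> gK xS; rewrite -[g]/(val (Sub g gK : fin_subgroup Kc)) -[x]/(val [` xS]%fset).
  rewrite phi1E psi1E pheA; have gxS := KS _ _ gK xS.
  rewrite -[act (val _) _]/(val [` gxS]%fset) psi1E; congr pse; exact: phi0A.
have subSK : substructure_in_K Delta [set` S] [set` K].
  split=> //; have [K1 Kd] := Kc; split; first by rewrite inE.
  by move=> g h; rewrite !inE; exact: Kd.
have phi11 : phi1 1%g = 1%g.
  by apply: (mulgI (phi1 1%g)); rewrite -phi1M ?mulg1//; have [] := Kc.
have phi1V h : h \in K -> phi1 h^-1%g = (phi1 h)^-1%g.
  move=> hK; apply: (mulgI (phi1 h)); rewrite mulgV -phi1M ?mulgV//.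
  exact: group_closedV Kc _ hK.
have sub2 : substructure_in_K Delta (psi1 @` [set` S]) (phi1 @` [set` K]).
  split.
  - exact/finite_image/finite_fset.
  - exact/finite_image/finite_fset.
  - split; first by rewrite inE; exists 1%g => //=; have [] := Kc.
    move=> _ _ /set_mem[g gK <-] /set_mem[h hK <-]; rewrite inE /=.
    exists (g * h^-1)%g => /=; first exact: (proj2 Kc).
    by rewrite phi1M ?phi1V//; exact: group_closedV Kc _ hK.
  - move=> _ _ [x xS <-] [y yS <-]; rewrite psi1D//; exact: dS.
  - move=> _ _ [g gK <-] [x xS <-]; exists (act g x); first exact: KS.
    by rewrite phi1A.
have iso1 : isomorphism_on [set` S] [set` K] (psi1 @` [set` S])
    (phi1 @` [set` K]) phi1 psi1.
  split=> //.
  - exact: inj_bij.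
  - apply: inj_bij => x y /set_mem xS /set_mem yS xy; apply: mdist_positivity.
    by rewrite -psi1D// xy mdistxx.
have [phi' [psi' [[phi'B phi'M psi'B psi'D phi'A] phi'E psi'E]]] :=
  ultra _ _ _ _ _ _ subSK sub2 iso1.
have [phi'' phiK phi''K] : bijective phi' by rewrite -setTT_bijective.
have [psi'' psiK psi''K] : bijective psi' by rewrite -setTT_bijective.
exists (phi'' \o phe), (psi'' \o pse); split.
- split.
  + move=> g h /=; apply: (can_inj phiK); rewrite phi'M// !phi''K; exact: pheM.
  + exact: inj_comp (can_inj phi''K) pheI.
  + by move=> x y _ _; rewrite -psi'D//= !psi''K pseD.
  + move=> g x /=; apply: (can_inj psiK); rewrite -phi'A// phi''K !psi''K.
    exact: pheA.
- by move=> g /=; rewrite -phi1E -phi'E ?phiK//; exact: valP.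
- by move=> x /=; rewrite -psi1E -psi'E ?psiK//; exact: valP.
Qed.

End FraisseLimit.

(** * Normalized counting measures *)

Section Proportion.
Variable R : realType.

(** The normalized counting measure of [K], for [K] in any type and not only in a
    topological group: it is used for subsets of the group of [M]. *)
Definition proportion (T : choiceType) (K A : set T) : R :=
  #|` fset_set (A `&` K)|%:R / #|` fset_set K|%:R.

Lemma proportion_image (T U : choiceType) (s : T -> U) (K : set T) (A : set U) :
  finite_set K -> {in K &, injective s} ->
  proportion (s @` K) A = proportion K (s @^-1` A).
Proof.
move=> Kfin sI.
have card (B : set T) : B `<=` K -> #|` fset_set (s @` B)| = #|` fset_set B|.
  move=> BK; have Bfin := sub_finite_set BK Kfin.
  rewrite fset_set_image// card_in_imfset//= => x y.
  rewrite !in_fset_set// => /set_mem/BK xK /set_mem/BK yK; apply: sI; exact/mem_set.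
rewrite /proportion card//; congr (_%:R / _).
rewrite -card; last by move=> x [].
congr (#|` fset_set _|); apply/seteqP; split=> [y [Ay [x Kx xy]]|_ [x [Ax Kx] <-]].
  by exists x => //; rewrite /= /preimage /= xy.
by split=> //; exists x.
Qed.

Lemma proportion_finType (T : finType) (A : set T) :
  proportion setT A = #|[set x | x \in A]%SET|%:R / #|T|%:R.
Proof.
have card (B : set T) : #|` fset_set B| = #|[set x | x \in B]%SET|.
  rewrite cardE -(size_map id); apply: perm_size.
  apply: uniq_perm; rewrite ?map_id ?fset_uniq ?enum_uniq// => x.
  by rewrite mem_enum inE in_fset_set//; exact: finite_finset.
rewrite /proportion setIT !card; congr (_ / _%:R).
by apply: eq_card => x; rewrite finset.inE mem_setT.
Qed.

Lemma proportion_le (T : choiceType) (K A B : set T) :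
  finite_set K -> A `<=` B -> proportion K A <= proportion K B.
Proof.
move=> Kf AB; rewrite ler_wpM2r ?invr_ge0// ler_nat fsubset_leq_card//.
rewrite -fset_set_sub; [exact: setSI|exact: finite_setIr..].
Qed.

Lemma proportion_le1 (T : choiceType) (K A : set T) :
  finite_set K -> proportion K A <= 1.
Proof.
move=> Kf; have [K0|K0] := eqVneq #|` fset_set K| 0%N.
  by rewrite /proportion K0 invr0 mulr0.
rewrite ler_pdivrMr ?mul1r ?ltr0n ?lt0n// ler_nat fsubset_leq_card//.
by rewrite -fset_set_sub//; exact: finite_setIr.
Qed.

End Proportion.

(** * Finite subgroups with the concentration property *)

Section LevySubgroups.
Variables (R : realType) (Delta : set R) (M : isometric_action R).
Hypothesis dvs : distance_value_set Delta.
Hypothesis Delta_inf : inf Delta = 0.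
Hypothesis M_limit : is_Fraisse_limit Delta M.

(** An element [h] lies in a finite group [K].  Left translations of [K] on the
    discrete space [K] form a member of the class in which [h] moves a point, and
    [Fraisse_extension], for the empty set of points, realizes it in [M] with [K]
    acting as it does in [M]. *)
Lemma Fraisse_limit_faithful (h : action_group M) :
  (forall x, act h x = x) -> h = 1%g.
Proof.
move=> h1; apply: contrapT => hn1.
have [eta eta_Delta _] := distance_value_small dvs Delta_inf ltr01.
have eta0 := distance_value_gt0 dvs eta_Delta.
case: (M_limit) => _ [S0 [K0 [sub _ _ KT]]] _ _.
have [n _ Kh] : (\bigcup_n K0 n) h by rewrite KT.
case: (sub n) => _ Kfin Kc _ _.
pose K := fset_set (K0 n).
have {}Kc : group_closed (mem K).
  case: Kc => K1 Kd; split; first by rewrite in_fset_set.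
  by move=> x y; rewrite !in_fset_set//; exact: Kd.
pose T := fin_subgroup Kc.
pose d (x y : T) : R := if x == y then 0 else eta.
have dP : is_dist d.
  split.
  - by move=> x; rewrite /d eqxx.
  - by move=> x y; rewrite /d; case: eqP => // _ /eqP; rewrite gt_eqF.
  - by move=> x y; rewrite /d eq_sym.
  - move=> y x z; rewrite /d; have [->|xz] := eqVneq x z.
      by rewrite eq_sym; case: ifP; rewrite ?addr0// addr_ge0// ltW.
    have [<-|xy] := eqVneq x y; first by rewrite (negPf xz) add0r.
    by case: ifP => _; rewrite ?addr0// lerDl ltW.
pose N := @IsometricAction R (dist_type dP) T
  (fun g x => (g * x)%g : dist_type dP)
  (@mul1g T) (fun g h x => esym (mulgA g h x))
  (fun g x y _ _ => congr1 (fun b : bool => if b then 0 else eta)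
                           (inj_eq (mulgI g) x y)).
have NK : in_K Delta N.
  split; [exact: (@finite_finset T)|exact: (@finite_finset T)|] => x y _ _.
  rewrite dist_typeE /d; case: (x =P y :> T) => [_|_ _]; last exact: eta_Delta.
  by rewrite eqxx.
have phi_psi := @Fraisse_extension _ _ _ M_limit fset0 K Kc N id
  (fun x => False_rect _ (notF (valP x))).
have [||//|//||||phi [psi [[_ phiI psiD phiA] phiE _]]] := phi_psi.
- by move=> x y.
- by move=> g x.
- by [].
- by move=> x; have := valP x.
- by move=> g x; have := valP x.
have hK : h \in K by rewrite in_fset_set//; exact/mem_set.
apply: hn1; rewrite -[h]/(val (Sub h hK : T)) -[RHS]/(val (1%g : T)); congr val.
have := phiA (Sub h hK : T) (1%g : T); rewrite phiE h1 => /esym.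
have psiI : injective psi.
  by move=> x y xy; apply: mdist_positivity; rewrite -(psiD x y)// xy mdistxx.
by move=> /psiI; rewrite /= mulg1.
Qed.

(** [L] is the image in [M] of a high power of the action of [K] on [S], with
    distances rounded to sums of distances of [S] and of some [eta < e] in
    [Delta]. *)
Lemma Levy_subgroup (S : set (action_space M)) (K : set (action_group M)) (e : R) :
  substructure_in_K Delta S K -> 0 < e ->
  exists L : set (action_group M),
    [/\ finite_set L, group_closed (mem L), K `<=` L &
    forall A, e <= proportion R L A ->
      1 - e <= proportion R L
        [set (v * a)%g | v in [set v | forall x, S x -> mdist (act v x) x < e]
                       & a in A `&` L]].
Proof.
move=> [Sfin Kfin Kc0 Sd KS0] e0.
pose S' := fset_set S; pose K' := fset_set K.
have Kc : group_closed (mem K').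
  case: Kc0 => K1 Kd; split; first by rewrite in_fset_set.
  by move=> x y; rewrite !in_fset_set//; exact: Kd.
have KS g x : g \in K' -> x \in S' -> act g x \in S'.
  by rewrite !in_fset_set// => /set_mem Kg /set_mem Sx; apply/mem_set/KS0.
have [eta eta_Delta eta_e] := distance_value_small dvs Delta_inf e0.
have eta0 := distance_value_gt0 dvs eta_Delta.
pose d (x y : S') : R := mdist (val x) (val y).
have dP : is_dist d.
  split=> [x|x y /mdist_positivity/val_inj//|x y|y x z]; first exact: mdistxx.
    exact: metric_sym.
  exact: metric_triangle.
pose V :=
  eta :: [seq v <- [seq d x y | x <- enum {: S'}, y <- enum {: S'}] | v != 0].
have etaV : eta \in V by rewrite mem_head.
have dV x y : d x y != 0 -> d x y \in V.
  by move=> xy; rewrite inE mem_filter xy allpairs_f ?orbT// mem_enum.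
pose D := \big[Num.max/eta]_(v <- V) v.
have VD v : v \in V -> v <= D by move=> vV; exact: le_bigmax_seq vV _.
have DV : D \in V.
  rewrite /D big_seq; elim/big_ind: _ => // x y xV yV.
  by rewrite /Num.max; case: ifP.
have D0 : 0 < D := lt_le_trans eta0 (VD _ etaV).
have dD x y : d x y <= D.
  by have [->|/dV/VD//] := eqVneq (d x y) 0; exact: ltW.
have VDelta v : v \in V -> Delta v /\ v <= D.
  move=> vV; split; last exact: VD.
  move: vV; rewrite inE => /orP[/eqP ->//|]; rewrite mem_filter.
  move=> /andP[v0 /allpairsP[[x y] /= [_ _ vE]]].
  by move: v0; rewrite vE; apply: Sd; apply/set_mem;
    rewrite -(in_fset_set Sfin); exact: valP.
have [r [r0 r_ge r_Delta [r_id r_le] r_sub]] := exists_rounding dvs VDelta DV.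
pose T := fin_subgroup Kc.
pose a (g : T) (x : S') : S' := [` KS _ _ (valP g) (valP x)]%fset.
have a1 x : a 1%g x = x by apply: val_inj; exact: act_one.
have aM g h x : a (g * h)%g x = a g (a h x) by apply: val_inj; exact: act_mul.
have a_isom g x y : d (a g x) (a g y) = d x y by exact: act_isometry.
pose n := Num.truncn (D ^+ 2 / (e ^+ 2 * eta ^+ 2)).
have nbig : D ^+ 2 <= e ^+ 2 * eta ^+ 2 * n.+1%:R.
  by rewrite mulrC -ler_pdivrMr ?mulr_gt0 ?exprn_gt0// ltW// truncnS_gt.
pose N := power_action dP dD r0 r_ge r_sub n a1 aM a_isom.
have NK : in_K Delta N := power_action_in_K _ _ _ _ r_Delta _ _ _ _ _.
have conc A := power_action_concentration (A := A) dP D0 dD r0 r_ge r_le r_sub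
  a1 etaV eta0 e0 nbig.
pose phi0 (g : fin_subgroup Kc) : action_group N := [ffun=> g].
pose psi0 (x : S') : action_space N := [ffun=> x].
have [|||||phi [psi [[phiM phiI psiD phiA] phiE psiE]]] :=
  Fraisse_extension M_limit (phi0 := phi0) (psi0 := psi0) _ KS NK.
- by move=> x y /= xS yS; apply: Sd; apply/set_mem; rewrite -(in_fset_set Sfin).
- by move=> g h; apply/ffunP => i; rewrite !ffunE.
- by move=> g h /ffunP /(_ ord0); rewrite !ffunE.
- by move=> x y; exact: (power_dist_const dV r0 r_id).
- move=> g x y gxy; apply/ffunP => i; rewrite !ffunE; exact: val_inj.
have finN : finite_set [set: action_group N] by case: NK.
exists (range phi); split.
- exact: finite_image.
- apply: group_closed_image phiM _; split; first exact: mem_setT.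
  by move=> g h _ _; exact: mem_setT.
- move=> g Kg; have gK : g \in K' by rewrite in_fset_set//; exact/mem_set.
  by exists (phi0 (Sub g gK)); rewrite // phiE.
move=> A; rewrite !proportion_image//; [|by move=> g h _ _; exact: phiI..].
pose L := {ffun 'I_n.+1 -> T}.
rewrite !(@proportion_finType R L).
have L0 : 0 < #|{: L}|%:R :> R by rewrite ltr0n; apply/card_gt0P; exists 1%g.
rewrite !ler_pdivlMr// => /conc/le_trans; apply.
rewrite ler_nat; apply/subset_leq_card/fintype.subsetP => g.
rewrite !finset.inE => /existsP[h /andP[]].
rewrite finset.inE => /set_mem Ah /forallP gh.
apply/mem_set; exists (phi (g * h^-1)%g) => /=.
  move=> x Sx; have xS : x \in S' by rewrite in_fset_set//; exact/mem_set.
  rewrite -[x]/(val [` xS]%fset) -psiE phiA psiD// (le_lt_trans _ eta_e)//.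
  exact: gh.
exists (phi h); first by split; [exact: Ah|exists h].
by rewrite -phiM mulgKV.
Qed.

End LevySubgroups.

(** * The action of the group on U *)

Lemma subset_chain (T : Type) (S : nat -> set T) :
  (forall n, S n `<=` S n.+1) -> forall m n, (m <= n)%N -> S m `<=` S n.
Proof.
move=> Snd m n mn; rewrite -(subnK mn); elim: (n - m)%N => // k IH.
exact: subset_trans IH (Snd _).
Qed.

Lemma finite_subset_chain (T : choiceType) (S : nat -> set T) (A : set T) :
  (forall n, S n `<=` S n.+1) -> \bigcup_n S n = setT -> finite_set A ->
  exists n, A `<=` S n.
Proof.
move=> Snd ST Afin; have [l] := (finite_seqP A).1 Afin.
elim: l A {Afin} => [|x l IH] A ->; first by exists 0%N => y.
have [n ln] := IH _ erefl; have [m _ Sx] : (\bigcup_n S n) x by rewrite ST.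
exists (maxn m n) => y /=; rewrite inE => /orP[/eqP ->|yl].
  exact: subset_chain (leq_maxl m n) _ Sx.
exact: subset_chain (leq_maxr m n) _ (ln y yl).
Qed.

Section TransportedGroup.
Variables (R : realType) (M : isometric_action R) (U : metricType R).
Variable f : action_space M -> U.
Hypotheses (f_isometry : isometric f) (f_bij : bijective f).
Local Notation T := (subgroup_type (transported_group f)).

Lemma transport_exists (h : action_group M) :
  exists g : T, forall x, iso_fun (val g) (f x) = f (act h x).
Proof.
case: f_bij => f' fK f'K.
have act_bij : bijective (act h).
  by exists (act h^-1%g) => x; rewrite -act_mul ?mulVg ?mulgV act_one.
pose F := f \o act h \o f'.
have Fi : isometric F.
  move=> x y _ _; rewrite /F /= f_isometry// act_isometry//.
  by rewrite -(f_isometry (x := f' x))// !f'K.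
have Fb : bijective F.
  by apply: bij_comp; [exact: bij_comp|exists f].
have FT : mk_iso Fi Fb \in (transported_group f : set _).
  by apply/mem_set; exists h => x; rewrite -[iso_fun _ _]/(F (f x)) /F /= fK.
exists (Sub (mk_iso Fi Fb) FT) => x.
by rewrite SubK -[iso_fun _ _]/(F (f x)) /F /= fK.
Qed.

Definition transport (h : action_group M) : T := sval (cid (transport_exists h)).

Lemma transportE h x : iso_fun (val (transport h)) (f x) = f (act h x).
Proof. by rewrite /transport; case: cid. Qed.

Lemma transport_uniq (g : T) h :
  (forall x, iso_fun (val g) (f x) = f (act h x)) -> g = transport h.
Proof.
move=> gh; apply: val_inj; apply: iso_ext => y; case: f_bij => f' _ f'K.
by rewrite -(f'K y) gh transportE.
Qed.

Lemma transportM : {morph transport : g h / (g * h)%g}.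
Proof.
move=> g h; apply/esym/transport_uniq => x.
by rewrite valM iso_funM !transportE act_mul.
Qed.

Lemma transport_surj (g : T) : exists h, g = transport h.
Proof.
by have /set_mem[h gh] := valP g; exists h; exact: transport_uniq.
Qed.

Lemma transport_inj :
  (forall h : action_group M, (forall x, act h x = x) -> h = 1%g) ->
  injective transport.
Proof.
move=> faithful g h gh; apply: (mulgI h^-1%g); rewrite mulVg.
apply: faithful => x; rewrite act_mul; apply: (bij_inj f_bij).
have : f (act g x) = f (act h x) by rewrite -!transportE gh.
by move=> /(bij_inj f_bij) ->; rewrite -act_mul mulVg act_one.
Qed.

(** The sets [W n] of the isometries that move the points of [f @` S n] by less
    than [n.+1%:R^-1] generate a filter that converges pointwise to 1, as every
    point of [U] lies in [f @` S n] for [n] large.  So every neighborhood of 1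
    contains some [W n]. *)
Lemma transport_nbhs1 (S : nat -> set (action_space M)) (V : set T) :
  (forall n, S n `<=` S n.+1) -> \bigcup_n S n = setT -> open V -> V 1%g ->
  exists n, forall h, (forall x, S n x -> mdist (act h x) x < n.+1%:R^-1) ->
    V (transport h).
Proof.
move=> Snd ST Vop V1.
have Sle m n : (m <= n)%N -> S m `<=` S n by exact: subset_chain.
pose W n : set (Iso U) :=
  [set g | forall x, S n x -> mdist (f x) (iso_fun g (f x)) < n.+1%:R^-1].
have Wle m n : (m <= n)%N -> W n `<=` W m.
  move=> mn g Wg x Smx; apply: lt_le_trans (Wg x _) _; first exact: Sle mn _ Smx.
  by rewrite lef_pV2 ?posrE ?ltr0n// ler_nat.
pose F := filter_from setT W.
have FF : Filter F.
  apply: filter_from_filter; first by exists 0%N.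
  move=> m n _ _; exists (maxn m n) => // g Wg.
  by split; apply: Wle Wg; rewrite ?leq_maxl ?leq_maxr.
have F1 : F --> (1%g : Iso U).
  apply/iso_cvgP => y; rewrite iso_fun1; apply/cvg_ballP => e e0.
  case: f_bij => f' fK f'K.
  have [m _ Sm] : (\bigcup_n S n) (f' y) by rewrite ST.
  have [k _ ke] := near_infty_natSinv_lt (PosNum e0).
  exists (maxn m k) => // g Wg; rewrite /= ballEmdist /= -(f'K y).
  apply: lt_trans (ke _ (leq_maxr m k)); apply: Wg.
  exact: Sle (leq_maxl m k) _ Sm.
have [_ [[B Bop <-] B1 BV]] : nbhs (1%g : T) V by exact: open_nbhs_nbhs.
have [n _ WB] : F B by apply: F1; exact: open_nbhs_nbhs.
exists n => h hS; apply: BV; apply: WB => x Snx.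
rewrite [set_val _]/(val _) transportE f_isometry// metric_sym; exact: hS.
Qed.

End TransportedGroup.

(** * The strong Levy property *)

Lemma limn_einf_gt0 (R : realType) (u : nat -> R) :
  (0 < limn_einf (fun i => (u i)%:E))%E ->
  exists2 c, 0 < c & \forall i \near \oo, c <= u i.
Proof.
rewrite limn_einf_lim (cvg_lim _ (@cvg_einfs_sup _ _))//.
move=> /ereal_sup_gt[_ [n _ <-]]; set e := einfs _ n => e0.
have eu k : (n <= k)%N -> (e <= (u k)%:E)%E.
  by move=> nk; apply: ereal_inf_lbound; exists k.
case: e e0 eu => [c c0 eu|_ eu|//]; last by have := eu n (leqnn n).
by exists c => //; exists n => // k /= /eu; rewrite lee_fin.
Qed.

Theorem theorem6p6 (R : realType) (Delta : set R)
    (Delta_countable : countable Delta)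
    (Delta_dvs : distance_value_set Delta)
    (Delta_inf : inf Delta = 0)
    (U : metricType R) (U_Urysohn : is_Urysohn Delta U)
    (M : isometric_action R) (M_limit : is_Fraisse_limit Delta M)
    (f : action_space M -> U) (f_isometry : isometric f) (f_bij : bijective f) :
  strong_Levy R (subgroup_type (transported_group f)).
Proof.
pose tau := transport f_isometry f_bij.
have tau_inj : injective tau.
  exact: transport_inj (Fraisse_limit_faithful Delta_dvs Delta_inf M_limit).
have tauM : {morph tau : g h / (g * h)%g} by exact: transportM.
case: (M_limit) => _ [S [H [sub mono ST HT]]] _ _.
have Snd n : S n `<=` S n.+1 := (mono n).1.
have Hle m n : (m <= n)%N -> H m `<=` H n.
  by apply: subset_chain => k; exact: (mono k).2.
have Sle m n : (m <= n)%N -> S m `<=` S n.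
  exact: subset_chain.
have e0 n : 0 < n.+1%:R^-1 :> R by rewrite invr_gt0 ltr0n.
have [L LP] := choice (fun n =>
  Levy_subgroup Delta_dvs Delta_inf M_limit (sub n) (e0 n)).
have absorb n : exists m, L n `<=` H m.
  have [Lfin _ _ _] := LP n.
  by apply: finite_subset_chain => // k; exact: (mono k).2.
(* Since [L n] need not lie in [H n.+1], the chain of the [L] has to skip indices. *)
have [next nextP] := choice absorb.
pose idx i := iter i (fun n => maxn (next n) n.+1) 0%N.
have idx_ge i : (i <= idx i)%N by elim: i => // i IH; rewrite leq_max ltnS IH orbT.
have Lmono i : L (idx i) `<=` L (idx i.+1).
  have [_ _ HL _] := LP (idx i.+1); apply: subset_trans HL.
  by apply: subset_trans (nextP _) _; apply: Hle; rewrite leq_maxl.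
have LT h : exists i, L (idx i) h.
  have [i _ Hh] : (\bigcup_n H n) h by rewrite HT.
  by exists i; have [_ _ HL _] := LP (idx i); apply: HL; exact: Hle (idx_ge i) _ Hh.
have Lc i : group_closed (mem (tau @` L (idx i))).
  by apply: group_closed_image => //; have [] := LP (idx i).
have measE i A : normalized_counting (tau @` L (idx i)) A =
    proportion R (L (idx i)) (tau @^-1` A).
  apply: proportion_image; first by have [] := LP (idx i).
  by move=> g h _ _; exact: tau_inj.
exists (fun i => Subgroup (Lc i)); split.
- by move=> i; apply: finite_image; have [] := LP (idx i).
- by move=> i; apply: image_subset; exact: Lmono.
- move=> O [g Og] _; exists g; split=> //.
  have [h ->] := transport_surj f_isometry f_bij g.
  by have [i Lh] := LT h; exists i => //; exists h.
move=> V Vop V1 A AK.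
have [n0 VP] := transport_nbhs1 f_isometry f_bij Snd ST Vop V1.
move=> /limn_einf_gt0[c c0 cA].
apply/cvgrPdist_le => e epos; near=> i.
have [Lfin _ _ Levy] := LP (idx i).
set d : R := (idx i).+1%:R^-1 in Levy.
have di : d <= i.+1%:R^-1 by rewrite lef_pV2 ?posrE ?ltr0n// ler_nat ltnS.
have dc : d <= c.
  rewrite (le_trans di)// ltW//; near: i.
  exact: (near_infty_natSinv_lt (PosNum c0)).
have de : d <= e.
  rewrite (le_trans di)// ltW//; near: i.
  exact: (near_infty_natSinv_lt (PosNum epos)).
have n0i : (n0 <= idx i)%N.
  by apply: leq_trans (idx_ge i); near: i; exact: nbhs_infty_ge.
have cAi : c <= normalized_counting (tau @` L (idx i)) (A i) by near: i.
rewrite /= measE ger0_norm; last by rewrite subr_ge0 proportion_le1.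
rewrite lerBlDr -lerBlDl (le_trans (lerB (lexx _) de))//.
apply: le_trans (Levy (tau @^-1` A i) _) _; first by rewrite -measE (le_trans dc).
apply: proportion_le => // _ [v vW [a [Aa La] <-]]; exists (tau v).
  apply: VP => x Sx; apply: lt_le_trans (vW x _) _; first exact: Sle n0i _ Sx.
  by rewrite lef_pV2 ?posrE ?ltr0n// ler_nat.
by exists (tau a); rewrite // -tauM.
Unshelve. all: by end_near.
Qed.
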